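(* Let $\eta>0$ and let $X$ be a random variable such that $0\trianglelefteq_\eta X$, i.e. $\mathbf E[e^{-\eta X}]\le1$. Then for any $a>0$, $$P(X\ge a)\le\frac{\mathbf E[X]}{a}+\frac{p\log(1/p)}{\eta a}\le\frac{\mathbf E[X]}{a}+\frac{1}{e\,\eta\, a},$$ where $p=P(X<0)$.
   Context: Random variables are real-valued with well-defined (possibly infinite) expectation. For $\eta>0$, $X\trianglelefteq_\eta Y$ means $\mathbf E[e^{\eta(X-Y)}]\le1$. $p\log(1/p)$ is read as $0$ when $p=0$; $e$ is Euler's number. *)

(* Defs.v *)
From HB Require Import structures.
From mathcomp Require Import all_boot all_order all_algebra.
From mathcomp Require Import all_classical all_reals all_analysis.
Set Implicit Arguments.
Unset Strict Implicit.
Unset Printing Implicit Defensive.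
Import Order.TTheory GRing.Theory Num.Theory.
Import numFieldNormedType.Exports.
Local Open Scope ring_scope.

(* 'E_P[X] is a difference of two nonnegative extended reals, to which the
   library gives the value -oo when both are +oo; that case is excluded here. *)
Definition has_expectation d (T : measurableType d) (R : realType)
    (P : probability T R) (X : T -> R) : Prop :=
  ('E_P[X^\+] < +oo)%E \/ ('E_P[X^\-] < +oo)%E.

(* [esi P eta X Y] is the exponential stochastic inequality usually written
   with a triangular order sign indexed by eta; it is used for [0 < eta]. *)
Definition esi d (T : measurableType d) (R : realType)
    (P : probability T R) (eta : R) (X Y : T -> R) : Prop :=
  ('E_P[fun w => expR (eta * (X w - Y w))] <= 1)%E.

(* Main.v *)
Require Import Defs.
From HB Require Import structures.
From mathcomp Require Import all_boot all_order all_algebra.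
From mathcomp Require Import all_classical all_reals all_analysis.
From mathcomp Require Import measurable_realfun lra.
Set Implicit Arguments.
Unset Strict Implicit.
Unset Printing Implicit Defensive.
Import Order.TTheory GRing.Theory Num.Theory.
Import numFieldNormedType.Exports.
Local Open Scope classical_set_scope.
Local Open Scope ring_scope.

(* Write N = {X < 0} and p = P(N). The tangent-line bound
   u + 1 <= q e^u + ln(1/q), applied on N with u = - eta X and integrated, gives
   eta E[X^-] + p <= q + p ln(1/q) whenever 0 < q <= 1. Taking q = p (or q -> 0
   when p = 0) yields eta E[X^-] <= p ln(1/p), and Markov's inequality for X^+
   then bounds a P(X >= a) by E[X^+] = E[X] + E[X^-]. *)

(** For [p > 0], the inequality [1 + u <= expR u] at [u = ln (1 / p) - 1] reads
    [ln (1 / p) <= p^-1 / expR 1]; multiplying by [p] gives the bound. *)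
Lemma xlnV_le (R : realType) (p : R) : 0 <= p -> p * ln (1 / p) <= (expR 1)^-1.
Proof.
rewrite le_eqVlt => /predU1P[<-|p_gt0].
  by rewrite mul0r invr_ge0 expR_ge0.
have h := expR_ge1Dx (ln (1 / p) - 1).
rewrite expRD lnK ?posrE ?divr_gt0// expRN in h.
rewrite -(ler_pM2l (_ : 0 < p^-1)) ?invr_gt0// mulKf ?gt_eqF//.
by move: h; rewrite addrC subrK div1r.
Qed.

(** The convex function [q * expR u] lies above its tangent at [u = ln (1 / q)], where its value and
    slope are both 1. *)
Lemma affine_le_expR (R : realType) (q u : R) : 0 < q ->
  u + 1 <= q * expR u + ln (1 / q).
Proof.
move=> q_gt0; have := expR_ge1Dx (u - ln (1 / q)).
rewrite expRB lnK ?posrE ?divr_gt0// div1r invrK mulrC.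
by lra.
Qed.

(** A finite ['E_P[X^\-]] cancels in the extended reals, even when ['E_P[X^\+]] is infinite. *)
Lemma expectation_funrneg (d : measure_display) (T : measurableType d)
    (R : realType) (P : probability T R) (X : {RV P >-> R}) :
  ('E_P[X^\-] < +oo -> 'E_P[X^\+] = 'E_P[X] + 'E_P[X^\-])%E.
Proof.
move=> Xn_fin; rewrite !unlock; rewrite unlock in Xn_fin.
rewrite [in RHS](integralE P setT (fun w => (X w)%:E)).
rewrite (funerpos X) (funerneg X) subeK// ge0_fin_numE//.
by apply: integral_ge0 => w _; rewrite lee_fin funrneg_ge0.
Qed.

Lemma markov_funrpos (d : measure_display) (T : measurableType d)
    (R : realType) (P : probability T R) (X : {RV P >-> R}) (a : R) :
  0 < a -> (a%:E * P [set w | (a <= X w)%R] <= 'E_P[X^\+])%E.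
Proof.
move=> a_gt0.
have mA : measurable [set w | (a <= X w)%R].
  by rewrite -preimage_itvcy; exact: measurable_funPTI.
rewrite unlock -[X in P X]setIT -integral_indic// -ge0_integralZl_EFin
  ?(ltW a_gt0)//.
- apply: ge0_le_integral => //.
  + by move=> w _; rewrite mule_ge0// lee_fin ?ltW.
  + apply/measurable_EFinP; apply: measurable_funM => //.
  + by apply/measurable_EFinP; apply: measurable_funrpos.
  + move=> w _; rewrite -EFinM lee_fin indicE /funrpos.
    case: (boolP (w \in _)) => [|_]; last by rewrite mulr0 le_max lexx orbT.
    by rewrite inE/= mulr1 le_max => ->.
- by apply/measurable_EFinP.
Qed.

(** The parameter [q] stays free because the natural choice, the probability that [X] is negative,
    may be 0. *)
Lemma esi0_funrneg_affine (d : measure_display) (T : measurableType d)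
    (R : realType) (P : probability T R) (X : {RV P >-> R}) (eta q : R) :
  0 < eta -> esi P eta (cst 0) X -> 0 < q <= 1 ->
  (eta%:E * 'E_P[X^\-] + P [set w | (X w < 0)%R]
     <= q%:E + (ln (1 / q))%:E * P [set w | (X w < 0)%R])%E.
Proof.
move=> eta_gt0 Xesi /andP[q_gt0 q_le1].
have mN : measurable [set w | (X w < 0)%R].
  by rewrite -preimage_itvNyo; exact: measurable_funPTI.
set N := [set w | (X w < 0)%R] in mN *.
(* This is where [q <= 1] enters: all integrands below are nonnegative, so the integrals split
   without any integrability condition. *)
have lnq_ge0 : 0 <= ln (1 / q) by rewrite ln_ge0// div1r invf_ge1.
pose Z w := expR (eta * (cst 0 w - X w)).
have mZ : measurable_fun setT (EFin \o Z).
  apply/measurable_EFinP; apply: measurableT_comp; first exact: measurable_expR.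
  by apply: measurable_funM => //; exact: measurable_funB.
have mI : measurable_fun setT (EFin \o (\1_N : T -> R)).
  exact/measurable_EFinP.
have mXn : measurable_fun setT (EFin \o X^\-).
  by apply/measurable_EFinP; apply: measurable_funrneg.
(* Since ['E_P[Z] <= 1], the constant [q] can be replaced by [q] times ['E_P[Z]], which leaves a
   pointwise comparison of integrands. *)
apply: (@le_trans _ _ (q%:E * 'E_P[Z] + (ln (1 / q))%:E * P N)%E); last first.
  by rewrite leeD2r// -[leRHS]mule1 lee_pmul2l//; exact: Xesi.
have -> : P N = (\int[P]_w (\1_N w)%:E)%E by rewrite integral_indic// setIT.
have I_ge0 w : (0 <= (\1_N w : R)%:E)%E by rewrite lee_fin indicE.
have Z_ge0 w : (0 <= (Z w)%:E)%E by rewrite lee_fin expR_ge0.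
have Xn_ge0 w : (0 <= (X^\- w)%:E)%E by rewrite lee_fin funrneg_ge0.
rewrite unlock -!ge0_integralZl_EFin ?(ltW eta_gt0) ?(ltW q_gt0)//.
have M_ge0 k (f : T -> \bar R) : 0 <= k -> (forall w, 0 <= f w)%E ->
    forall w, setT w -> (0 <= k%:E * f w)%E.
  by move=> k_ge0 f_ge0 w _; rewrite mule_ge0.
have mM k (f : T -> \bar R) : measurable_fun setT f ->
    measurable_fun setT (fun w => k%:E * f w)%E.
  exact: measurable_funeM.
rewrite -!ge0_integralD//; try by [apply: M_ge0 => //; exact: ltW | exact: mM].
apply: ge0_le_integral => //.
- by move=> w _; rewrite adde_ge0// mule_ge0// lee_fin ltW.
- by apply: emeasurable_funD => //; exact: mM.
- by apply: emeasurable_funD; exact: mM.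
- move=> w _; rewrite -!EFinM -!EFinD lee_fin indicE /funrneg /Z sub0r mulrN.
  have [wN|wN] := boolP (w \in N).
    have Xw_lt0 : X w < 0 by move: wN; rewrite inE.
    rewrite max_l ?oppr_ge0 ?(ltW Xw_lt0)// !mulr1 mulrN.
    exact: affine_le_expR.
  (* Off [N] the left integrand vanishes and the right one is [q * Z w], which is nonnegative. *)
  have Xw_ge0 : 0 <= X w by rewrite leNgt; apply: contra wN; rewrite inE.
  by rewrite max_r ?oppr_le0// !mulr0 !addr0 mulr_ge0 ?expR_ge0 ?ltW.
Qed.

Lemma esi0_funrneg (d : measure_display) (T : measurableType d)
    (R : realType) (P : probability T R) (X : {RV P >-> R}) (eta : R)
    (p := fine (P [set w | X w < 0])) :
  0 < eta -> esi P eta (cst 0) X ->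
  (eta%:E * 'E_P[X^\-] <= (p * ln (1 / p))%:E)%E.
Proof.
move=> eta_gt0 Xesi.
have mN : measurable [set w | X w < 0].
  by rewrite -preimage_itvNyo; exact: measurable_funPTI.
have PN : P [set w | X w < 0] = p%:E by rewrite fineK// fin_num_measure.
have p_ge0 : 0 <= p by rewrite fine_ge0.
have p_le1 : p <= 1 by rewrite -lee_fin -PN probability_le1.
have key q := @esi0_funrneg_affine _ _ _ P X eta q eta_gt0 Xesi.
rewrite PN in key.
move: p_ge0; rewrite le_eqVlt => /predU1P[p0|p_gt0].
  rewrite -p0 mul0r; apply/lee_addgt0Pr => e e_gt0; rewrite add0e.
  (* With [p = 0] the affine bound reduces to [eta * 'E_P[X^\-] <= q]; the minimum keeps [q] in the
     allowed range and below [e]. *)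
  have := key (Num.min e 1); rewrite -p0 mule0 !adde0 => /(_ _)/le_trans; apply.
    by rewrite lt_min e_gt0 ltr01 ge_min lexx orbT.
  by rewrite lee_fin ge_min lexx.
(* With [q = p] the finite summand [p] occurs on both sides and cancels. *)
have := key p; rewrite p_gt0 p_le1 => /(_ isT).
by rewrite addeC -EFinM leeD2lE// mulrC.
Qed.

Theorem proposition12 (d : measure_display) (T : measurableType d)
    (R : realType) (P : probability T R) (X : {RV P >-> R}) (eta : R)
    (eta_gt0 : 0 < eta)
    (X_exp : has_expectation P X)
    (X_esi : esi P eta (cst 0) X)
    (a : R) (a_gt0 : 0 < a) :
  let p : R := fine (P [set w | X w < 0]) in
  (P [set w | (a <= X w)%R]
     <= 'E_P[X] * (a^-1)%:E + (p * ln (1 / p) / (eta * a))%:E)%E /\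
  ('E_P[X] * (a^-1)%:E + (p * ln (1 / p) / (eta * a))%:E
     <= 'E_P[X] * (a^-1)%:E + (1 / (expR 1 * eta * a))%:E)%E.
Proof.
move=> p; have Xn_le := esi0_funrneg eta_gt0 X_esi; rewrite -/p in Xn_le.
have p_ge0 : 0 <= p by rewrite fine_ge0.
have Xn_le' : ('E_P[X^\-] <= (p * ln (1 / p) / eta)%:E)%E.
  by rewrite EFinM lee_pdivlMr// muleC.
split.
- have Xn_fin := le_lt_trans Xn_le' (ltry _).
  (* Factoring out [a^-1] is legitimate even if ['E_P[X]] is infinite, because the other summand is
     a real number. Multiplying through by [a] then leads to Markov's inequality. *)
  rewrite invfM mulrA EFinM -muleDl//; last exact: fin_num_adde_defl.
  rewrite lee_pdivlMr// muleC (le_trans (markov_funrpos _ a_gt0))//.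
  by rewrite expectation_funrneg// leeD2l.
- rewrite leeD2l// lee_fin -(mulrA (expR 1)) (invfM (expR 1)) [leRHS]mul1r.
  by rewrite ler_pM2r ?invr_gt0 ?mulr_gt0// xlnV_le.
Qed.
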